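(* Let $K$ be a field, $X=\{x_1,x_2,\ldots\}$ a finite or countable set, $F=K\langle X\rangle$ the free associative algebra, $P=K[X\times\mathbb{N}^*]$, $\sigma:P\to P$ the algebra endomorphism $x_i(j)\mapsto x_i(j+1)$, and $S=P[s;\sigma]$. The graded algebra homomorphism $\iota:F\to S$, $x_i\mapsto x_i(1)s$, is injective. Hence $F$ is isomorphic to $R=\mathrm{Im}\,\iota$, which is a graded monomial subalgebra of $S$.
   Context: $\mathbb{N}^*=\{1,2,\ldots\}$. $P=K[X\times\mathbb{N}^*]$ is the commutative polynomial ring in the variables $x_i(j)=(x_i,j)$. $S=P[s;\sigma]$ is the skew polynomial ring: the free left $P$-module with basis $\{s^i\}_{i\ge 0}$ and multiplication determined by $s f=\sigma(f)s$ for $f\in P$. $S=\bigoplus_{i\ge0}S_i$ is graded by $S_i=Ps^i$; $F$ is graded by total degree (each $x_i$ has degree 1). $\mathrm{Mon}(P)$ is the set of monomials of $P$ (including 1) and $\mathrm{Mon}(S)=\{m s^i\mid m\in\mathrm{Mon}(P), i\ge 0\}$, which is a multiplicative monoid and a $K$-basis of $S$. A $K$-subalgebra $A\subset S$ is called a monomial subalgebra if it is the $K$-span of a submonoid of $\mathrm{Mon}(S)$. *)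

(* Defs.v *)
From HB Require Import structures.
From mathcomp Require Import all_boot all_order all_algebra.
From mathcomp Require Import finmap boolp.
From mathcomp.multinomials Require Import monalg.

Set Implicit Arguments.
Unset Strict Implicit.
Unset Printing Implicit Defensive.

Import GRing.Theory.
Local Open Scope ring_scope.

Definition graded_morphism (A B : Type) (gA : nat -> {pred A})
    (gB : nat -> {pred B}) (f : A -> B) : Prop :=
  forall d, {homo f : a / a \in gA d >-> a \in gB d}.

(* U is the sum of the U :&: g d (the sum is direct when that of the g d is). *)
Definition graded_subspace (V : zmodType) (g : nat -> {pred V}) (U : {pred V})
    : Prop :=
  forall u, u \in U -> exists n (c : 'I_n -> V),
    (forall d : 'I_n, c d \in U /\ c d \in g d) /\ u = \sum_(d < n) c d.

Definition in_span (K : fieldType) (V : lmodType K) (M : {pred V}) (v : V)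
    : Prop :=
  exists n (k : 'I_n -> K) (m : 'I_n -> V),
    (forall i, m i \in M) /\ v = \sum_(i < n) k i *: m i.

Section Image.
Context (K : fieldType) (A B : algType K) (f : {lrmorphism A -> B}).

Definition image_alg : {pred B} := fun b => `[< exists a, f a = b >].

Lemma image_algP b : reflect (exists a, f a = b) (b \in image_alg).
Proof. exact: asboolP. Qed.

Fact image_alg_closed : subalg_closed image_alg.
Proof.
split; first by apply/image_algP; exists 1; rewrite rmorph1.
  move=> k b c /image_algP[x <-] /image_algP[y <-]; apply/image_algP.
  by exists (k *: x + y); rewrite linearP.
move=> b c /image_algP[x <-] /image_algP[y <-]; apply/image_algP.
by exists (x * y); rewrite rmorphM.
Qed.

HB.instance Definition _ :=
  GRing.isSubalgClosed.Build K B image_alg image_alg_closed.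

Definition image_alg_type := {b : B | b \in image_alg}.

HB.instance Definition _ := SubChoice.on image_alg_type.
HB.instance Definition _ :=
  [SubChoice_isSubAlgebra of image_alg_type by <:].

End Image.

(* The algebra of the free monoid over X. The alias is there because the
   library equips {malg _[M]} with an algType structure for commutative M
   only. *)
Definition free_alg (K : fieldType) (X : choiceType) := {malg K[{fmonom X}]}.

Section FreeAlgebra.
Context (K : fieldType) (X : choiceType).

HB.instance Definition _ :=
  GRing.Lalgebra.copy (free_alg K X) {malg K[{fmonom X}]}.

Fact free_alg_scalerAr (k : K) (f g : free_alg K X) :
  k *: (f * g) = f * (k *: g).
Proof.
apply/malgP => w; rewrite mcoeffZ.
rewrite (mcoeffMlw w (fsubset_refl (msupp f)) (fsubset_refl (msupp g))).
rewrite (mcoeffMlw w (fsubset_refl (msupp f)) (msuppZ_le k g)) mulr_sumr.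
apply: eq_bigr => u _; rewrite mulr_sumr; apply: eq_bigr => v _.
by rewrite mcoeffZ !mulrnAr mulrCA.
Qed.

HB.instance Definition _ :=
  GRing.Lalgebra_isAlgebra.Build K (free_alg K X) free_alg_scalerAr.

Definition free_var (x : X) : free_alg K X := << fmu x >>.

Definition free_homog (d : nat) : {pred free_alg K X} :=
  fun f => all (fun w => fdeg w == d) (msupp f).

End FreeAlgebra.

Section FreeExtension.
Context (K : fieldType) (X : choiceType) (A : algType K) (a : X -> A).

Definition word_ext (w : {fmonom X}) : A := \prod_(x <- (w : seq X)) a x.

Fact word_ext_mmorphism : mmorphism word_ext.
Proof. by split=> [u v|]; rewrite /word_ext ?fm1 ?big_nil // fmM big_cat. Qed.

HB.instance Definition _ :=
  isMultiplicative.Build _ _ word_ext word_ext_mmorphism.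

Definition free_ext (f : free_alg K X) : A := mmap (in_alg A) word_ext f.

Fact free_ext_is_zmod_morphism : zmod_morphism free_ext.
Proof. exact: mmap_is_additive. Qed.

Fact free_ext_is_monoid_morphism : monoid_morphism free_ext.
Proof.
have [|fM f1] := @commr_mmap_is_multiplicative _ _ _ (in_alg A) word_ext.
  by move=> g u v; rewrite /GRing.comm mulr_algl mulr_algr.
by split.
Qed.

Fact free_ext_is_scalable : scalable free_ext.
Proof. by move=> k f; rewrite /free_ext mmapZ mulr_algl. Qed.

HB.instance Definition _ :=
  GRing.isZmodMorphism.Build _ _ free_ext free_ext_is_zmod_morphism.
HB.instance Definition _ :=
  GRing.isMonoidMorphism.Build _ _ free_ext free_ext_is_monoid_morphism.
HB.instance Definition _ :=
  GRing.isScalable.Build K _ _ *:%R free_ext free_ext_is_scalable.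

Lemma free_ext_var x : free_ext (free_var K x) = a x.
Proof.
by rewrite /free_ext mmapU /= scale1r mul1r /word_ext fmU big_seq1.
Qed.

End FreeExtension.

(* V may be infinite, hence not {mpoly K[n]}. *)
Notation poly_alg K V := {malg K[{cmonom V}]}.

Definition poly_var (K : fieldType) (V : choiceType) (v : V) : poly_alg K V :=
  << ucm v >>.

Section PolyExtension.
Context (K : fieldType) (V : choiceType) (A : comAlgType K) (a : V -> A).

Definition monom_ext (m : {cmonom V}) : A := \prod_(v <- finsupp m) a v ^+ m v.

Lemma monom_extEw (m : {cmonom V}) (d : {fset V}) : (finsupp m `<=` d)%fset ->
  monom_ext m = \prod_(v <- d) a v ^+ m v.
Proof.
move=> le_md; rewrite /monom_ext [LHS](big_fset_incl _ le_md) //= => v _.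
by rewrite -cmE_eq0 => /eqP->.
Qed.

Fact monom_ext_mmorphism : mmorphism monom_ext.
Proof.
split=> [m1 m2|]; last by rewrite /monom_ext mdom1 big_seq_fset0.
rewrite (@monom_extEw _ (finsupp (mmul m1 m2))) //.
rewrite (@monom_extEw m1 (finsupp (mmul m1 m2))) ?mdomD ?fsubsetUl //.
rewrite (@monom_extEw m2 (finsupp m1 `|` finsupp m2)%fset) ?fsubsetUr //.
by rewrite -big_split; apply: eq_bigr => v _; rewrite cmM exprD.
Qed.

HB.instance Definition _ :=
  isMultiplicative.Build _ _ monom_ext monom_ext_mmorphism.

Definition poly_ext (p : poly_alg K V) : A := mmap (in_alg A) monom_ext p.

Fact poly_ext_is_zmod_morphism : zmod_morphism poly_ext.
Proof. exact: mmap_is_additive. Qed.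

Fact poly_ext_is_monoid_morphism : monoid_morphism poly_ext.
Proof.
have [fM f1] := @mmap_is_multiplicative _ _ _ (in_alg A) monom_ext.
by split.
Qed.

Fact poly_ext_is_scalable : scalable poly_ext.
Proof. by move=> k f; rewrite /poly_ext mmapZ mulr_algl. Qed.

HB.instance Definition _ :=
  GRing.isZmodMorphism.Build _ _ poly_ext poly_ext_is_zmod_morphism.
HB.instance Definition _ :=
  GRing.isMonoidMorphism.Build _ _ poly_ext poly_ext_is_monoid_morphism.
HB.instance Definition _ :=
  GRing.isScalable.Build K _ _ *:%R poly_ext poly_ext_is_scalable.

Lemma poly_ext_var v : poly_ext (poly_var K v) = a v.
Proof.
by rewrite /poly_ext mmapU /= scale1r mul1r /monom_ext mdomU big_seq_fset1 cmUU.
Qed.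

End PolyExtension.

(* R[s; sigma]: the coefficient p`_i : R is the one of s^i, on the left. *)
Definition skewpoly (K : fieldType) (R : algType K)
  (sigma : {lrmorphism R -> R}) := {poly R}.

Section Iter.
Context (K : fieldType) (R : algType K) (sigma : {lrmorphism R -> R}) (i : nat).

Fact iter_is_zmod_morphism : zmod_morphism (iter i sigma).
Proof. by move=> a b; elim: i => //= n ->; rewrite rmorphB. Qed.

Fact iter_is_monoid_morphism : monoid_morphism (iter i sigma).
Proof.
split=> [|a b]; first by elim: i => //= n ->; rewrite rmorph1.
by elim: i => //= n ->; rewrite rmorphM.
Qed.

Fact iter_is_scalable : scalable (iter i sigma).
Proof. by move=> k a; elim: i => //= n ->; rewrite linearZ. Qed.

HB.instance Definition _ :=
  GRing.isZmodMorphism.Build R R (iter i sigma) iter_is_zmod_morphism.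
HB.instance Definition _ :=
  GRing.isMonoidMorphism.Build R R (iter i sigma) iter_is_monoid_morphism.
HB.instance Definition _ :=
  GRing.isScalable.Build K R R *:%R (iter i sigma) iter_is_scalable.

End Iter.

Section SkewPoly.
Context (K : fieldType) (R : algType K) (sigma : {lrmorphism R -> R}).

Implicit Types (p q r : {poly R}).

HB.instance Definition _ := GRing.Zmodule.copy (skewpoly sigma) {poly R}.

(* (a s^i) (b s^j) = a sigma^i(b) s^(i + j), extended biadditively. *)
Definition skew_mul p q : {poly R} :=
  \poly_(i < (size p + size q).-1)
    (\sum_(j < i.+1) p`_j * iter j sigma q`_(i - j)).

Lemma coef_skew_mul p q i :
  (skew_mul p q)`_i = \sum_(j < i.+1) p`_j * iter j sigma q`_(i - j).
Proof.
rewrite coef_poly ltn_predRL; case: leqP => // le_pq_i1.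
rewrite big1 // => j _; have [lq_p_j|lt_j_p] := leqP (size p) j.
  by rewrite nth_default ?mul0r.
rewrite [q`__]nth_default ?raddf0 ?mulr0 // leq_subRL -ltnS //.
by rewrite (leq_trans _ le_pq_i1) // ltn_add2r.
Qed.

Fact coef_skew_mul_rev p q i :
  (skew_mul p q)`_i = \sum_(j < i.+1) p`_(i - j) * iter (i - j) sigma q`_j.
Proof.
rewrite coef_skew_mul (reindex_inj rev_ord_inj) /=.
by apply: eq_bigr => j _; rewrite (sub_ordK j).
Qed.

Fact skew_mulA : associative skew_mul.
Proof.
move=> p q r; apply/polyP=> i; rewrite coef_skew_mul coef_skew_mul_rev.
pose coef3 j k :=
  p`_j * (iter j sigma q`_(i - j - k) * iter (i - k) sigma r`_k).
transitivity (\sum_(j < i.+1) \sum_(k < i.+1 | (k <= i - j)%N) coef3 j k).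
  apply: eq_bigr => /= j _; rewrite coef_skew_mul_rev raddf_sum big_distrr /=.
  rewrite (big_ord_narrow_leq (leq_subr _ _)); apply: eq_bigr => k _ /=.
  rewrite rmorphM /= /coef3 -iterD; congr (_ * (_ * iter _ _ _)).
  have le_ki : (k <= i)%N := leq_trans (leq_ord k) (leq_subr _ _).
  by rewrite subnAC subnKC // leq_subRL // addnC -leq_subRL ?leq_ord.
rewrite (exchange_big_dep predT) //=; apply: eq_bigr => k _.
transitivity (\sum_(j < i.+1 | (j <= i - k)%N) coef3 j k).
  apply: eq_bigl => j; rewrite -ltnS -(ltnS j) -!subSn ?leq_ord //.
  by rewrite -subn_gt0 -(subn_gt0 j) -!subnDA addnC.
rewrite (big_ord_narrow_leq (leq_subr _ _)) coef_skew_mul big_distrl /=.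
by apply: eq_bigr => j _; rewrite /coef3 -!subnDA addnC mulrA.
Qed.

Fact skew_mul1l : left_id 1%:P skew_mul.
Proof.
move=> p; apply/polyP => i; rewrite coef_skew_mul big_ord_recl subn0 coefC.
by rewrite mul1r big1 ?addr0 // => j _; rewrite coefC mul0r.
Qed.

Fact skew_mul1r : right_id 1%:P skew_mul.
Proof.
move=> p; apply/polyP => i; rewrite coef_skew_mul_rev big_ord_recl subn0 coefC.
by rewrite rmorph1 mulr1 big1 ?addr0 // => j _; rewrite coefC raddf0 mulr0.
Qed.

Fact skew_mulDl : left_distributive skew_mul +%R.
Proof.
move=> p q r; apply/polyP=> i; rewrite coefD !coef_skew_mul -big_split.
by apply: eq_bigr => j _; rewrite coefD mulrDl.
Qed.

Fact skew_mulDr : right_distributive skew_mul +%R.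
Proof.
move=> p q r; apply/polyP=> i; rewrite coefD !coef_skew_mul -big_split.
by apply: eq_bigr => j _; rewrite coefD rmorphD mulrDr.
Qed.

HB.instance Definition _ := GRing.Zmodule_isNzRing.Build (skewpoly sigma)
  skew_mulA skew_mul1l skew_mul1r skew_mulDl skew_mulDr (poly1_neq0 R).

Definition skew_scale (k : K) p : {poly R} := (k%:A : R) *: p.

Fact skew_scaleA k l p :
  skew_scale k (skew_scale l p) = skew_scale (k * l) p.
Proof. by rewrite /skew_scale scalerA mulr_algl scalerA. Qed.

Fact skew_scale1 : left_id 1 skew_scale.
Proof. by move=> p; rewrite /skew_scale !scale1r. Qed.

Fact skew_scaleDr : right_distributive skew_scale +%R.
Proof. by move=> k p q; rewrite /skew_scale scalerDr. Qed.

Fact skew_scaleDl p : {morph skew_scale^~ p : k l / k + l}.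
Proof. by move=> k l; rewrite /skew_scale !scalerDl. Qed.

HB.instance Definition _ :=
  GRing.Zmodule_isLmodule.Build K (skewpoly sigma)
    skew_scaleA skew_scale1 skew_scaleDr skew_scaleDl.

Fact skew_scaleAl k p q :
  skew_scale k (skew_mul p q) = skew_mul (skew_scale k p) q.
Proof.
apply/polyP => i; rewrite coefZ !coef_skew_mul mulr_sumr.
by apply: eq_bigr => j _; rewrite coefZ mulrA.
Qed.

HB.instance Definition _ :=
  GRing.Lmodule_isLalgebra.Build K (skewpoly sigma) skew_scaleAl.

Fact skew_scaleAr k p q :
  skew_scale k (skew_mul p q) = skew_mul p (skew_scale k q).
Proof.
apply/polyP => i; rewrite coefZ !coef_skew_mul mulr_sumr.
apply: eq_bigr => j _; rewrite coefZ !mulr_algl linearZ /=.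
by rewrite scalerAr.
Qed.

HB.instance Definition _ :=
  GRing.Lalgebra_isAlgebra.Build K (skewpoly sigma) skew_scaleAr.

Definition skewC (a : R) : skewpoly sigma := a%:P.
Definition skewX : skewpoly sigma := 'X.

Lemma skewXC a : skewX * skewC a = skewC (sigma a) * skewX.
Proof.
apply/polyP => i; rewrite [LHS]coef_skew_mul_rev [RHS]coef_skew_mul.
rewrite !big_ord_recl !big1 => [|j _|j _]; last 2 first.
- by rewrite coefC mul0r.
- by rewrite coefC raddf0 mulr0.
by rewrite !addr0 /= !subn0 !coefC !coefX; case: i => [|[|i]];
  rewrite ?mulr0 ?mul0r ?mulr1 ?mul1r.
Qed.

Lemma skewCXnE a i :
  (skewC a * skewX ^+ i : skewpoly sigma) = (a *: 'X^i : {poly R}).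
Proof.
suff -> : (skewX ^+ i : skewpoly sigma) = ('X^i : {poly R}).
  apply/polyP => j; rewrite [LHS]coef_skew_mul big_ord_recl big1 => [|k _].
    by rewrite addr0 subn0 coefC coefZ.
  by rewrite coefC mul0r.
elim: i => // i IH; rewrite exprS [in RHS]exprS -commr_polyX -IH.
apply/polyP => j; rewrite [LHS]coef_skew_mul.
rewrite -[RHS]/((skewX ^+ i : {poly R}) * 'X)`_j coefMX.
case: j => [|j]; first by rewrite big_ord_recl big_ord0 coefX mul0r addr0.
rewrite 2!big_ord_recl big1 => [|k _]; last by rewrite coefX mul0r.
by rewrite !coefX mul0r add0r addr0 mul1r /= subSS subn0 IH coefXn rmorph_nat.
Qed.

Definition skew_homog (i : nat) : {pred skewpoly sigma} :=
  fun y => `[< exists a, y = skewC a * skewX ^+ i >].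

End SkewPoly.

Definition posN := {j : nat | (0 < j)%N}.
Definition posN1 : posN := exist _ 1%N isT.
Definition posNS (j : posN) : posN := exist _ (val j).+1 isT.

Section Letterplace.
Context (K : fieldType) (X : countType).

Local Notation P := (poly_alg K (X * posN)%type).

Definition letter_shift : {lrmorphism P -> P} :=
  poly_ext (fun v : X * posN => poly_var K (v.1, posNS v.2)).

Local Notation S := (skewpoly letter_shift).

Definition MonS : {pred S} := fun y =>
  `[< exists (m : {cmonom (X * posN)%type}) i,
        y = skewC letter_shift << m >> * skewX letter_shift ^+ i >].

Definition monomial_subalgebra (A : {pred S}) : Prop :=
  subalg_closed A /\
  exists M : {pred S}, [/\ {subset M <= MonS}, mulr_closed M &
    forall y, y \in A <-> in_span M y].

Definition letterplace : {lrmorphism free_alg K X -> S} :=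
  free_ext (fun x : X =>
    skewC letter_shift (poly_var K (x, posN1)) * skewX letter_shift).

End Letterplace.

(* Main.v *)
(** A word [x_1 ... x_n] is sent to [x_1(1) x_2(2) ... x_n(n) s^n]: moving the
    powers of [s] to the right past [x_k(1)] turns it into [x_k(k)]. The word
    can be read off this monomial, so [letterplace] maps the basis of words
    injectively to monomials of [S], homogeneously for the two gradings. *)
Require Import Defs.
From mathcomp Require Import all_boot all_order all_algebra.
From HB Require Import structures.
From mathcomp Require Import finmap boolp.
From mathcomp.multinomials Require Import monalg.

Set Implicit Arguments.
Unset Strict Implicit.
Unset Printing Implicit Defensive.

Import GRing.Theory.
Local Open Scope ring_scope.

(** * Corestriction of an algebra morphism to its image *)

Section ImageIso.
Context (K : fieldType) (A B : algType K) (f : {lrmorphism A -> B}).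

Definition corestrict (a : A) : image_alg_type f :=
  exist _ (f a) (introT (image_algP f (f a)) (ex_intro _ a erefl)).

Fact corestrict_is_zmod_morphism : zmod_morphism corestrict.
Proof. by move=> a b; apply: val_inj; rewrite /= rmorphB. Qed.

Fact corestrict_is_monoid_morphism : monoid_morphism corestrict.
Proof.
by split=> [|a b]; apply: val_inj; rewrite /= ?rmorph1 ?rmorphM.
Qed.

Fact corestrict_is_scalable : scalable corestrict.
Proof. by move=> k a; apply: val_inj; rewrite /= linearZ. Qed.

HB.instance Definition _ := GRing.isZmodMorphism.Build A (image_alg_type f)
  corestrict corestrict_is_zmod_morphism.
HB.instance Definition _ := GRing.isMonoidMorphism.Build A (image_alg_type f)
  corestrict corestrict_is_monoid_morphism.
HB.instance Definition _ := GRing.isScalable.Build K A (image_alg_type f) *:%R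
  corestrict corestrict_is_scalable.

Lemma corestrict_bij : injective f -> bijective corestrict.
Proof.
(* Choice turns the mere existence of preimages into a function, the candidate inverse; injectivity
   is needed only for the left cancellation. *)
move=> f_inj; have preim (b : image_alg_type f) : {a | f a = val b}.
  by apply: cid; apply/image_algP; apply: valP.
exists (fun b => sval (preim b)) => [a|b]; last first.
  by apply: val_inj => /=; apply: svalP (preim b).
by apply: f_inj; apply: svalP (preim (corestrict a)).
Qed.

End ImageIso.

(** Serves to pass from a sum over the support of an element to the ordinal-indexed sums of
    [in_span]. *)
Lemma in_span_sum (K : fieldType) (V : lmodType K) (M : {pred V}) (I : eqType)
    (r : seq I) (k : I -> K) (m : I -> V) :
  (forall i, m i \in M) -> in_span M (\sum_(i <- r) k i *: m i).
Proof.
move=> mM; exists (size r), (fun i => k (tnth (in_tuple r) i)).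
by exists (fun i => m (tnth (in_tuple r) i)); split=> //; rewrite big_tnth.
Qed.

(** * Calculus of monomials and homogeneous elements in a skew polynomial ring *)

Section SkewPoly.
Context (K : fieldType) (R : algType K) (sigma : {lrmorphism R -> R}).

Lemma skewXnC n (a : R) :
  skewX sigma ^+ n * skewC sigma a =
  skewC sigma (iter n sigma a) * skewX sigma ^+ n.
Proof.
elim: n => [|n IH]; first by rewrite expr0 mul1r mulr1.
by rewrite [in LHS]exprS -mulrA IH mulrA skewXC -mulrA -exprS.
Qed.

Lemma skewC1 : skewC sigma 1 = 1.
Proof. exact: erefl. Qed.

Lemma skewCM : {morph skewC sigma : a b / a * b}.
Proof.
move=> a b; apply/polyP => i; rewrite [RHS]coef_skew_mul big_ord_recl big1.
  by rewrite subn0 addr0 !coefC /=; case: eqP => // _; rewrite mulr0.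
by move=> j _; rewrite coefC mul0r.
Qed.

Lemma skewCXM a b m n :
  (skewC sigma a * skewX sigma ^+ m) * (skewC sigma b * skewX sigma ^+ n) =
  skewC sigma (a * iter m sigma b) * skewX sigma ^+ (m + n).
Proof.
by rewrite -mulrA [X in _ * X]mulrA skewXnC skewCM exprD !mulrA.
Qed.

Lemma skewCD : {morph skewC sigma : a b / a + b}.
Proof. by move=> a b; apply: polyCD. Qed.

Lemma skewCZ : scalable (skewC sigma).
Proof.
move=> k a; apply/polyP=> i; rewrite [RHS]coefZ !coefC mulr_algl.
by case: eqP => //; rewrite scaler0.
Qed.

Lemma skew_homogP i (y : skewpoly sigma) :
  reflect (exists a, y = skewC sigma a * skewX sigma ^+ i)
    (y \in skew_homog i).
Proof. exact: asboolP. Qed.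

Lemma skew_homog_sum i (I : eqType) (r : seq I) (F : I -> skewpoly sigma) :
    {in r, forall j, F j \in skew_homog i} ->
  \sum_(j <- r) F j \in skew_homog i.
Proof.
move=> homF; rewrite big_seq; elim/big_rec: _ => [|j y /homF/skew_homogP[a ->]].
  by apply/skew_homogP; exists 0; rewrite /skewC polyC0 mul0r.
move=> /skew_homogP[b ->]; apply/skew_homogP; exists (a + b).
by rewrite skewCD mulrDl.
Qed.

Lemma skew_homogZ i k (y : skewpoly sigma) :
  y \in skew_homog i -> k *: y \in skew_homog i.
Proof.
move=> /skew_homogP[a ->]; apply/skew_homogP; exists (k *: a).
by rewrite skewCZ scalerAl.
Qed.

(** Two scalings by [K] meet here: in [skewpoly] it is left multiplication of the coefficients by
    [k%:A], in [R] that of the algebra. *)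
Lemma coef_skew_sum (I : Type) (r : seq I) (k : I -> K)
    (F : I -> skewpoly sigma) i :
  (\sum_(j <- r) k j *: F j : {poly R})`_i =
  \sum_(j <- r) k j *: (F j : {poly R})`_i.
Proof.
elim: r => [|j r IH]; first by rewrite !big_nil [LHS]coef0.
by rewrite !big_cons -IH [LHS]coefD [X in X + _]coefZ mulr_algl.
Qed.

End SkewPoly.

Lemma monalgUM (M : monomType) (R : nzRingType) (u v : M) :
  << mmul u v >> = << u >> * << v >> :> {malg R[M]}.
Proof. by rewrite malgM_def fgmulUU mulr1. Qed.

Lemma iter_posNS n : val (iter n posNS posN1) = n.+1.
Proof. by elim: n => //= n ->. Qed.

Lemma iter_posNS_inj : injective (fun n => iter n posNS posN1).
Proof. by move=> m n /(congr1 val); rewrite !iter_posNS => -[]. Qed.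

(** * Encoding words as monomials *)

Section Letterplace.
Context (K : fieldType) (X : countType).

Local Notation P := (poly_alg K (X * posN)%type).
Local Notation sigma := (letter_shift K X).
Local Notation S := (skewpoly sigma).
Local Notation iota := (letterplace K X).

(* [iter n posNS posN1] is the place [n.+1]: places start at 1, indices at 0. *)
Definition place (w : seq X) : {cmonom (X * posN)%type} :=
  \big[mmul/mone]_(v <- zip w (traject posNS posN1 (size w))) ucm v.

Lemma place_rcons w x :
  place (rcons w x) = mmul (place w) (ucm (x, iter (size w) posNS posN1)).
Proof.
rewrite /place size_rcons trajectSr zip_rcons ?size_traject //.
by rewrite -cats1 big_cat big_seq1.
Qed.

(** Place [n.+1] is occupied by the letter of index [n] alone, and once, so the exponents are the
    indicator of the letters of the word. *)
Lemma placeE w x n :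
  place w (x, iter n posNS posN1) = (onth w n == Some x) :> nat.
Proof.
elim/last_ind: w => [|w y IH]; first by rewrite /place big_nil cm1 onth0n.
rewrite place_rcons cmM IH cmU -cats1 onth_cat xpair_eqE.
rewrite (inj_eq iter_posNS_inj).
(* The appended letter only affects [n = size w], an index beyond the end of [w], so the two
   summands are never both 1. *)
have [lt_nw|le_wn] := ltnP n (size w); first by rewrite gtn_eqF // andbF addn0.
rewrite onth_default //= add0n.
have [->|ne_wn] := eqVneq (size w) n; first by rewrite subnn andbT.
by rewrite andbF onth_default //= subn_gt0 ltn_neqAle ne_wn.
Qed.

(** The exponents at place [n.+1] determine [onth w n], including the value [None], so the length is
    recovered as well. *)
Lemma place_inj : injective place.
Proof.
move=> u v eq_uv; apply: eq_from_onth => n.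
(* Both tests are, as numbers, the same exponent of the common monomial; [odd] recovers a boolean
   from its number. *)
have onthE x : (onth u n == Some x) = (onth v n == Some x).
  by apply: (can_inj oddb); rewrite -!placeE eq_uv.
case eq_u: (onth u n) => [x|]; first by apply/esym/eqP; rewrite -onthE eq_u.
by case eq_v: (onth v n) => [x|] //; have := onthE x; rewrite eq_u eq_v eqxx.
Qed.

(** * The image of a word *)

Lemma letter_shift_var x j :
  sigma (poly_var K (x, j)) = poly_var K (x, posNS j).
Proof. exact: poly_ext_var. Qed.

Lemma letter_shift_iter n x j :
  iter n sigma (poly_var K (x, j)) = poly_var K (x, iter n posNS j).
Proof.
elim: n => [|n IH]; first exact: erefl.
rewrite [LHS]iterS IH; exact: letter_shift_var.
Qed.

Definition place_skew (w : seq X) : S :=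
  skewC sigma << place w >> * skewX sigma ^+ size w.

(** Moving [s ^ size w] past [x(1)] shifts it to place [(size w).+1], which is where [place] puts an
    appended letter. *)
Lemma place_skew_rcons w x :
  place_skew (rcons w x) =
  place_skew w * (skewC sigma (poly_var K (x, posN1)) * skewX sigma).
Proof.
rewrite -[skewX sigma in RHS]expr1 [RHS]skewCXM letter_shift_iter.
by rewrite /place_skew place_rcons size_rcons addn1 monalgUM.
Qed.

Lemma word_ext_letterplace (w : {fmonom X}) :
  word_ext (fun x : X => skewC sigma (poly_var K (x, posN1)) * skewX sigma) w =
  place_skew w.
Proof.
rewrite /word_ext; elim/last_ind: (w : seq X) => [|u x IH].
  by rewrite big_nil /place_skew expr0 mulr1 [place _]big_nil mpolyC1E skewC1.
rewrite place_skew_rcons -IH -cats1 big_cat big_seq1; exact: erefl.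
Qed.

Lemma letterplaceE (f : free_alg K X) :
  iota f = \sum_(w <- msupp f) f@_w *: place_skew w.
Proof.
rewrite [LHS]mmapE; apply: eq_bigr => w _.
by rewrite mulr_algl word_ext_letterplace.
Qed.

Lemma letterplace_word (w : {fmonom X}) : iota << w >> = place_skew w.
Proof.
by rewrite letterplaceE msuppU1 big_seq_fset1 mcoeffUU scale1r.
Qed.

Lemma place_skewE w :
  place_skew w = (<< place w >> *: 'X^(size w) : {poly P}).
Proof. exact: skewCXnE. Qed.

(** Images of distinct words are distinct basis monomials: [place] already separates them, and equal
    words have equal powers of [s]. *)
Lemma coef_place_skew (u w : seq X) :
  (place_skew u : {poly P})`_(size w) @_(place w) = (u == w)%:R.
Proof.
rewrite place_skewE coefZ coefXn mulr_natr mcoeffMn mcoeffU1.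
rewrite (inj_eq place_inj); case: eqP => [->|_]; first by rewrite eqxx.
by rewrite mul0rn.
Qed.

(** Every coefficient of [f] can be read off its image, hence injectivity. *)
Lemma coef_letterplace (f : free_alg K X) (w : {fmonom X}) :
  (iota f : {poly P})`_(size w) @_(place w) = f@_w.
Proof.
rewrite letterplaceE coef_skew_sum raddf_sum [in RHS](monalgE f) raddf_sum.
apply: eq_bigr => u _; rewrite /= mcoeffZ coef_place_skew mcoeffU fmP.
by rewrite mulr_natr.
Qed.

Lemma letterplace_inj : injective iota.
Proof.
by move=> f g eq_fg; apply/malgP=> w; rewrite -!coef_letterplace eq_fg.
Qed.

(** * Gradings and the monomial structure of the image *)

Lemma letterplace_graded :
  graded_morphism (@free_homog K X) (@skew_homog _ _ sigma) iota.
Proof.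
move=> d f /allP homf; rewrite letterplaceE; apply: skew_homog_sum => w.
(* The degree of a word is its length, the exponent of [s] in its image. *)
move=> /homf/eqP <-; apply: skew_homogZ; apply/skew_homogP.
by exists << place w >>.
Qed.

Lemma free_alg_graded (f : free_alg K X) :
  exists n (c : 'I_n -> free_alg K X),
    (forall d : 'I_n, c d \in @free_homog K X d) /\ f = \sum_(d < n) c d.
Proof.
(* This bound strictly exceeds the degree of every word in the support, so each such word lies in
   exactly one of the components below. *)
exists (mmeasure (@fdeg X) f).
exists (fun d : 'I_(_) => [malg w in msupp f => f@_w *+ (fdeg w == d)]).
split=> [d|].
  apply/allP => w; rewrite -mcoeff_neq0 mcoeffE.
  by case: ifP => _; [case: (fdeg w == d)|]; rewrite ?mulr0n ?eqxx.
apply/malgP => w; rewrite raddf_sum /=.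
under eq_bigr do rewrite mcoeffE.
case: msuppP => [w_f|_]; last by rewrite big1.
have lt_w := mmeasure_mnm_lt (@fdeg X) w_f.
rewrite (bigD1 (Ordinal lt_w)) //= eqxx big1 ?addr0 // => d.
by rewrite -val_eqE eq_sym /= => /negPf->.
Qed.

(** The components of an image are the images of the components, hence stay in the image. *)
Lemma image_letterplace_graded :
  graded_subspace (@skew_homog _ _ sigma) (image_alg iota).
Proof.
move=> y /image_algP[f <-]; have [n [c [homc ->]]] := free_alg_graded f.
exists n, (fun d => iota (c d)); split; last exact: raddf_sum.
move=> d; split; last by apply: letterplace_graded.
by apply/image_algP; exists (c d).
Qed.

Lemma image_letterplace_monomial : monomial_subalgebra (image_alg iota).
Proof.
split; first exact: image_alg_closed.
(* The monoid is the image of the free monoid of words, closed under products because concatenation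
   is the product of words. *)
exists (fun y => `[< exists w : {fmonom X}, y = iota << w >> >]); split.
- move=> y /asboolP[w ->]; apply/asboolP; exists (place w), (size w).
  exact: letterplace_word.
- split=> [|y z /asboolP[u ->] /asboolP[v ->]]; apply/asboolP.
    by exists mone; rewrite mpolyC1E rmorph1.
  by exists (mmul u v); rewrite monalgUM rmorphM.
move=> y; split=> [/image_algP[f <-]|[n [k [m [mM ->]]]]].
  rewrite letterplaceE; apply: in_span_sum => w; apply/asboolP; exists w.
  by rewrite letterplace_word.
apply: rpred_sum => i _; apply: rpredZ.
by have /asboolP[w ->] := mM i; apply/image_algP; exists << w >>.
Qed.

End Letterplace.

Theorem proposition6p2 (K : fieldType) (X : countType) :
  [/\ forall x : X,
        letterplace K X (free_var K x) =
        skewC (letter_shift K X) (poly_var K (x, posN1)) * skewX (letter_shift K X),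
      graded_morphism (@free_homog K X) (@skew_homog _ _ (letter_shift K X))
        (letterplace K X),
      injective (letterplace K X),
      exists phi : {lrmorphism free_alg K X -> image_alg_type (letterplace K X)},
        bijective phi /\ forall f, val (phi f) = letterplace K X f &
      graded_subspace (@skew_homog _ _ (letter_shift K X)) (image_alg (letterplace K X))
      /\ monomial_subalgebra (image_alg (letterplace K X))].
Proof.
split.
- by move=> x; apply: free_ext_var.
- exact: letterplace_graded.
- exact: letterplace_inj.
- exists (corestrict (letterplace K X)); split=> //.
  exact/corestrict_bij/letterplace_inj.
split; first exact: image_letterplace_graded.
exact: image_letterplace_monomial.
Qed.
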